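(* Let $N \geq 1$ be an integer, let $0<p<1$, and let $(X_n)$ be a random Binomial-Fibonacci $\mathcal{BF}(N,p)$ sequence. Then there exists a finite deterministic real number $L(p)$ (the Lyapunov exponent, depending only on $N$ and $p$) such that $$\lim_{n\to\infty} \frac{1}{n}\log(X_n) = L(p) \quad \text{almost surely},$$ and this convergence also holds in $\mathbb{L}^1$. Moreover, if $(X_n)$ is a Bernoulli-Fibonacci $\mathcal{BF}(p)$ sequence (that is, $N=1$), then $$L(p)=\mathbb{E}\left[\log\left(\frac{F_{G+3}}{F_{G+2}}\right)\right]=\sum_{k=0}^\infty p(1-p)^k \log\left(\frac{F_{k+3}}{F_{k+2}}\right),$$ where $(F_k)$ is the Fibonacci sequence and $G$ is a random variable with Geometric $\mathcal{G}(p)$ distribution.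
   Context: Random Binomial-Fibonacci $\mathcal{BF}(N,p)$ sequence: $X_0=1$, $X_1=1$; for all $1\leq n\leq N$, $X_{n+1}=X_n+X_{n-1}$; and for all $n\geq N+1$, $X_{n+1}=X_n+X_{n+\theta_{n+1}-N}$, where $(\theta_n)_{n\geq N+2}$ is a sequence of independent random variables with the Binomial $\mathcal{B}(N,p)$ distribution, i.e. $\mathbb{P}(\theta_{n}=k)=\binom{N}{k}p^k(1-p)^{N-k}$ for $0\leq k\leq N$ (in particular $\theta_{n+1}$ is independent of $X_1,\ldots,X_n$). The Bernoulli-Fibonacci $\mathcal{BF}(p)$ sequence is the case $N=1$: $X_0=X_1=1$, $X_2=2$, and $X_{n+1}=(1+\theta_{n+1})X_n+(1-\theta_{n+1})X_{n-1}$ for $n\geq 2$ with $\theta_{n+1}$ Bernoulli $\mathcal{B}(p)$. $(F_k)_{k\ge 0}$ is the classical Fibonacci sequence: $F_0=0$, $F_1=1$, $F_{k+2}=F_{k+1}+F_k$. The Geometric $\mathcal{G}(p)$ distribution is $\mathbb{P}(G=k)=p(1-p)^k$ for all $k\geq 0$. *)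

(* Defs.v *)
From HB Require Import structures.
From mathcomp Require Import all_boot all_order all_algebra finmap.
From mathcomp Require Import all_classical all_reals all_analysis.

Set Implicit Arguments.
Unset Strict Implicit.
Unset Printing Implicit Defensive.

Import Order.TTheory GRing.Theory Num.Theory.
Import numFieldNormedType.Exports.

Local Open Scope classical_set_scope.
Local Open Scope ring_scope.

Definition mutually_independent d d' (T : measurableType d)
    (T' : measurableType d') (R : realType) (P : probability T R)
    (I : choiceType) (D : set I) (X : I -> {RV P >-> T'}) : Prop :=
  forall (J : {fset I}) (A : I -> set T'),
    [set` J] `<=` D -> (forall i, measurable (A i)) ->
    P (\bigcap_(i in [set` J]) (X i @^-1` A i)) =
    (\prod_(i <- J) P (X i @^-1` A i))%E.

(* When theta n.+1 <= N, the subtraction below does not truncate (N < n), and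
   the index n + theta n.+1 - N lies between n - N and n. *)
Definition BF_recursion (R : realType) (N : nat) (theta : nat -> nat)
    (x : nat -> R) : Prop :=
  [/\ x 0%N = 1, x 1%N = 1,
      forall n, (1 <= n <= N)%N -> x n.+1 = x n + x n.-1
    & forall n, (N.+1 <= n)%N ->
        x n.+1 = x n + x (n + theta n.+1 - N)%N].

(* Only theta n with n >= N + 2 matters. A random variable with the binomial
   distribution takes its values in {0, ..., N} only almost surely, hence the
   recursion is required almost surely. *)
Definition binomial_fibonacci d (T : measurableType d) (R : realType)
    (P : probability T R) (N : nat) (p : R) (theta : nat -> {RV P >-> nat})
    (X : nat -> {RV P >-> R}) : Prop :=
  [/\ mutually_independent [set n | (N.+2 <= n)%N] theta,
      forall n, (N.+2 <= n)%N ->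
        forall A : set nat, distribution P (theta n) A = binomial_prob N p A
    & \forall t \ae P, BF_recursion N (theta ^~ t) (X ^~ t)].

Definition cvg_L1 d (T : measurableType d) (R : realType) (P : probability T R)
    (Y : nat -> T -> R) (l : R) : Prop :=
  (forall n, Y n \in Lfun P 1) /\
  ('N[P]_1[EFin \o (Y n \- cst l)%R])%E @[n --> \oo] --> 0%E.

Fixpoint fib (n : nat) : nat :=
  if n is m.+1 then (if m is k.+1 then fib m + fib k else 1)%N else 0%N.

(* Geometric law on {0, 1, 2, ...}: number of failures before the first
   success. *)
Definition geometric_rv d (T : measurableType d) (R : realType)
    (P : probability T R) (p : R) (G : {RV P >-> nat}) : Prop :=
  forall k, P (G @^-1` [set k]) = (p * (1 - p) ^+ k)%:E.

Definition log_fib_ratio (R : realType) (k : nat) : R :=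
  ln ((fib (k + 3))%:R / (fib (k + 2))%:R).

(* Main.v *)
(** Replacing one draw of [theta] changes the current state by a factor at most
2, and the recursion is linear and positive, so all later terms change by a
factor at most 2. Hence the martingale of the conditional means of [ln X_n] has
increments bounded by [ln 2], which gives a variance of order [n]. The same
comparison of states makes the mean of [ln X_n] almost additive in [n], so it is
[n * L + O(1)]. Thus [E (ln X_n - n * L) ^ 2 = O(n)]; this gives the convergence
in L1, and the almost sure convergence along the squares, which extends to all
[n] because [ln X_n] is nondecreasing.

For [N = 1], the ratio [X_n / X_(n-1)] is always of the form
[F_(k+3) / F_(k+2)], and a draw moves [k] to [k + 1] with probability [1 - p]
and to [0] with probability [p]. Solving the Poisson equation of this chain
identifies [L]. *)
Require Import Defs.
From HB Require Import structures.
From mathcomp Require Import all_boot all_order all_algebra finmap.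
From mathcomp Require Import all_classical all_reals all_analysis.
From mathcomp Require Import measurable_realfun.
From mathcomp Require Import ring lra zify.

Set Implicit Arguments.
Unset Strict Implicit.
Unset Printing Implicit Defensive.

Import Order.TTheory GRing.Theory Num.Theory.
Import numFieldNormedType.Exports.

Local Open Scope classical_set_scope.
Local Open Scope ring_scope.

(** * Almost additive real sequences *)

Lemma almost_additive_linear (R : realType) (a : nat -> R) (C : R) :
  (forall n m, `|a (n + m)%N - a n - a m| <= C) ->
  exists L, forall n, `|a n - n%:R * L| <= C.
Proof.
move=> aC; have C0 : 0 <= C := le_trans (normr_ge0 _) (aC 0%N 0%N).
(* Splitting off one block of length [m] costs [C], and [q] splittings are made. *)
have aM q m : `|a (q.+1 * m)%N - q.+1%:R * a m| <= q%:R * C.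
  elim: q => [|q IH]; first by rewrite mul1n !mul1r mul0r subrr normr0.
  rewrite mulSn.
  have -> : a (m + q.+1 * m)%N - q.+2%:R * a m =
    (a (m + q.+1 * m)%N - a m - a (q.+1 * m)%N)
      + (a (q.+1 * m)%N - q.+1%:R * a m).
    by rewrite -(natr1 q.+1); ring.
  by rewrite (le_trans (ler_normD _ _))// (le_trans (lerD (aC _ _) IH))//
    -natr1; lra.
(* Both slopes are compared with [a (n.+1 * m.+1)], read as [m.+1] blocks of length [n.+1] and as
   [n.+1] blocks of length [m.+1]. So every lower slope is below every upper slope, and the supremum
   of the lower ones serves as [L]. *)
have key n m : (a n.+1 - C) / n.+1%:R <= (a m.+1 + C) / m.+1%:R.
  rewrite ler_pdivrMr ?ltr0n// mulrAC ler_pdivlMr ?ltr0n//.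
  have := aM m n.+1; have := aM n m.+1; rewrite [(m.+1 * _)%N]mulnC.
  rewrite !ler_norml -!natr1.
  move: (a (n.+1 * m.+1)%N) (a n.+1) (a m.+1) => u v w.
  move=> /andP[_ h1] /andP[h2 _].
  by move: h1 h2; lra.
pose A := range (fun n => (a n.+1 - C) / n.+1%:R).
have A0 : A !=set0 by exists ((a 1%N - C) / 1%:R); exists 0%N.
have Aub : has_ubound A.
  by exists ((a 1%N + C) / 1%:R) => _ [n _ <-]; exact: (key n 0%N).
exists (sup A) => -[|n].
  by rewrite mul0r subr0 -normrN; have := aC 0%N 0%N; rewrite subrr sub0r.
have h1 : (a n.+1 - C) / n.+1%:R <= sup A by apply: ub_le_sup => //; exists n.
have h2 : sup A <= (a n.+1 + C) / n.+1%:R.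
  by apply: ge_sup => // _ [m _ <-]; exact: key.
rewrite ler_pdivrMr ?ltr0n// in h1; rewrite ler_pdivlMr ?ltr0n// in h2.
by rewrite ler_norml; apply/andP; split; lra.
Qed.

(* A state lists the terms of the sequence, the most recent one first. *)
Definition step (R : realType) (N a : nat) (s : seq R) : seq R :=
  (s`_0 + s`_(N - a)) :: s.

(** This is the expectation of [g] after [m] independent draws from [s], kept as a finite sum;
    [integral_word] ties it to a probability space. *)
Fixpoint mean (R : realType) (N : nat) (b : nat -> R) (m : nat)
    (g : seq R -> R) (s : seq R) : R :=
  if m is k.+1 then \sum_(a < N.+1) b a * mean N b k g (step N a s) else g s.

(** Only the [N + 1] entries that the recursion can read are constrained. The invariant keeps each
    of them within a factor [2 ^+ N] of the head. *)
Definition good (R : realType) (N : nat) (s : seq R) : Prop :=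
  (forall i, (i <= N)%N -> 0 < s`_i) /\
  (forall i, (i < N)%N -> s`_i.+1 <= s`_i <= 2 * s`_i.+1).

Definition dom (R : realType) (N : nat) (K : R) (s s' : seq R) : Prop :=
  forall i, (i <= N)%N -> s`_i <= K * s'`_i.

Definition log_head (R : realType) (s : seq R) : R := ln s`_0.

(** * Comparison of states and averages over the draws *)

Section states.
Context (R : realType) (N : nat).
Implicit Types (s t : seq R) (K : R).

Lemma good_le_head s i : good N s -> (i <= N)%N -> s`_i <= s`_0.
Proof.
move=> [_ h]; elim: i => // i IH iN.
by have /andP[+ _] := h _ iN; move/le_trans; apply; apply: IH; exact: ltnW.
Qed.

Lemma good_head_le s i : good N s -> (i <= N)%N -> s`_0 <= 2 ^+ i * s`_i.
Proof.
move=> [_ h]; elim: i => [|i IH] iN; first by rewrite mul1r.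
have /andP[_ h2] := h _ iN.
rewrite (le_trans (IH (ltnW iN)))// exprSr -mulrA.
by rewrite ler_pM2l ?exprn_gt0.
Qed.

Lemma good_step a s : good N s -> good N (step N a s).
Proof.
move=> gs; have [s_gt0 s_ratio] := gs.
have s0 := s_gt0 0%N isT.
have sa := s_gt0 (N - a)%N (leq_subr _ _).
have sale := good_le_head gs (leq_subr a N).
split=> [[|i]|[|i]] /= iN.
- by rewrite addr_gt0.
- exact/s_gt0/ltnW.
- by apply/andP; split; lra.
- by apply: s_ratio; exact: ltnW.
Qed.

Lemma dom_step a K s t : dom N K s t -> dom N K (step N a s) (step N a t).
Proof.
move=> d [|i] iN /=; last exact/d/ltnW.
by rewrite mulrDr lerD ?d// leq_subr.
Qed.

(** Both new heads lie between the old head and its double; the other entries are common to the two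
    states. *)
Lemma dom_step_step a a' s : good N s -> dom N 2 (step N a s) (step N a' s).
Proof.
move=> gs [|i] iN /=.
  have := good_le_head gs (leq_subr a N).
  by have := gs.1 (N - a')%N (leq_subr _ _); lra.
by have := gs.1 i (ltnW iN); lra.
Qed.

(** Each entry of [s] is at most its head, and each entry of [t] is at least its head divided by
    [2 ^+ N]. *)
Lemma dom_good s t : good N s -> good N t ->
  dom N (s`_0 * 2 ^+ N / t`_0) s t.
Proof.
move=> gs gt i iN.
have t0 := gt.1 0%N isT; have s0 := gs.1 0%N isT; have ti := gt.1 i iN.
rewrite mulrAC ler_pdivlMr// -mulrA; apply: ler_pM.
- exact/ltW/gs.1.
- exact/ltW.
- exact: good_le_head.
- rewrite (le_trans (good_head_le gt iN))// ler_pM2r//.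
  by rewrite ler_eXn2l// ltr1n.
Qed.

Section mean.
Context (b : nat -> R) (b_ge0 : forall a, 0 <= b a)
  (b_sum1 : \sum_(a < N.+1) b a = 1).
Local Notation mean := (mean N b).
Implicit Type g : seq R -> R.

Lemma average_cst (c : R) : \sum_(a < N.+1) b a * c = c.
Proof. by rewrite -big_distrl/= b_sum1 mul1r. Qed.

Lemma average_le (u v : 'I_N.+1 -> R) : (forall a, u a <= v a) ->
  \sum_(a < N.+1) b a * u a <= \sum_(a < N.+1) b a * v a.
Proof. by move=> uv; apply: ler_sum => a _; rewrite ler_wpM2l. Qed.

(** The second moment about [c] is the variance plus the squared bias. Pairwise closeness puts every
    value within [K] of the average, which bounds the variance. *)
Lemma average_sqr (u : 'I_N.+1 -> R) (K c : R) :
  (forall i j, `|u i - u j| <= K) ->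
  \sum_(a < N.+1) b a * (u a - c) ^+ 2 <=
  K ^+ 2 + (\sum_(a < N.+1) b a * u a - c) ^+ 2.
Proof.
move=> uK; set v := \sum_(a < _) b a * u a.
have vK i : `|u i - v| <= K.
  rewrite ler_norml; apply/andP; split.
    rewrite lerBrDr -lerBrDl opprK -[leRHS]average_cst average_le// => j.
    by have := uK j i; rewrite ler_norml => /andP[]; lra.
  rewrite lerBlDr -lerBlDl -[leLHS]average_cst average_le// => j.
  by have := uK j i; rewrite ler_norml => /andP[]; lra.
have -> : \sum_(a < N.+1) b a * (u a - c) ^+ 2 =
    \sum_(a < N.+1) b a * (u a - v) ^+ 2 + (v - c) ^+ 2.
  transitivity (\sum_(a < N.+1) (b a * (u a - v) ^+ 2 +
      (2 * (v - c) * (b a * u a) + b a * (c ^+ 2 - v ^+ 2)))).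
    by apply: eq_bigr => a _; ring.
  by rewrite big_split big_split/= average_cst -big_distrr/= -/v; ring.
rewrite lerD2r -[leRHS]average_cst average_le// => i.
rewrite -[leLHS]real_normK ?num_real// ler_pXn2r// ?nnegrE//.
exact: le_trans (vK i).
Qed.

Lemma mean_add n m g s : mean (n + m) g s = mean n (mean m g) s.
Proof.
by elim: n s => //= n IH s; apply: eq_bigr => a _; rewrite IH.
Qed.

Lemma mean_le n g h s : (forall t, good N t -> g t <= h t) ->
  good N s -> mean n g s <= mean n h s.
Proof.
move=> gh; elim: n s => [|n IH] s gs /=; first exact: gh.
by apply: average_le => a; apply: IH; exact: good_step.
Qed.

Lemma mean_addr n g c s : mean n (fun t => g t + c) s = mean n g s + c.
Proof.
elim: n s => //= n IH s; under eq_bigr do rewrite IH mulrDr.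
by rewrite big_split/= average_cst.
Qed.

(** Coupling: both states undergo the same draws, and [dom_step] carries the constant [K] unchanged
    to the end. *)
Lemma mean_log_head_dom n K s t : 0 < K -> good N s -> good N t ->
  dom N K s t ->
  mean n (@log_head R) s <= ln K + mean n (@log_head R) t.
Proof.
move=> K0; elim: n s t => [|n IH] s t gs gt d /=.
  rewrite /log_head -lnM ?posrE ?gt.1//.
  by rewrite ler_ln ?posrE ?mulr_gt0 ?gs.1 ?gt.1// d.
rewrite -[ln K]average_cst -big_split/=.
under [leRHS]eq_bigr do rewrite -mulrDr.
by apply: average_le => a; apply: IH; [exact: good_step..|exact: dom_step].
Qed.

(* By [dom_step_step], changing one draw changes the conditional mean of
   the logarithm by at most [ln 2]: the martingale of conditional means has
   bounded increments. *)
Lemma mean_log_head_sqr n c s : good N s ->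
  mean n (fun t => (log_head t - c) ^+ 2) s <=
  n%:R * ln 2 ^+ 2 + (mean n (@log_head R) s - c) ^+ 2.
Proof.
elim: n s => [|n IH] s gs /=; first by rewrite mul0r add0r.
apply: (@le_trans _ _ (\sum_(a < N.+1) b a * (n%:R * ln 2 ^+ 2 +
    (mean n (@log_head R) (step N a s) - c) ^+ 2))).
  by apply: average_le => a; apply: IH; exact: good_step.
under [leLHS]eq_bigr do rewrite mulrDr.
rewrite big_split/= average_cst -(natr1 n) mulrDl mul1r -addrA lerD2l.
apply: average_sqr => i j; rewrite ler_distl.
have := mean_log_head_dom n (ltr0n R 2) (good_step i gs) (good_step j gs)
  (dom_step_step i j gs).
have := mean_log_head_dom n (ltr0n R 2) (good_step j gs) (good_step i gs)
  (dom_step_step j i gs).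
by move=> h1 h2; apply/andP; split; lra.
Qed.

Lemma mean_log_head_good n s t : good N s -> good N t ->
  mean n (@log_head R) s <=
  log_head s + N%:R * ln 2 - log_head t + mean n (@log_head R) t.
Proof.
move=> gs gt; have s0 := gs.1 0%N isT; have t0 := gt.1 0%N isT.
have K0 : 0 < s`_0 * 2 ^+ N / t`_0 by rewrite divr_gt0// mulr_gt0 ?exprn_gt0.
rewrite (le_trans (mean_log_head_dom n K0 gs gt (dom_good gs gt)))//.
rewrite lerD2r ln_div ?posrE ?mulr_gt0 ?exprn_gt0//.
by rewrite lnM ?posrE ?exprn_gt0// lnXn// mulr_natl.
Qed.

(** The state [t] reached after [n] draws is traded for [s] by [mean_log_head_good], in both
    directions and at a cost independent of [m]. The next [m] draws then add their mean from [s], up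
    to [C]; averaging over [t] gives almost additivity. *)
Lemma mean_log_head_linear s : good N s ->
  exists L C, forall n, `|mean n (@log_head R) s - n%:R * L| <= C.
Proof.
move=> gs; pose C := `|N%:R * ln 2| + `|log_head s|.
suff /almost_additive_linear[L hL] : forall n m,
    `|mean (n + m)%N (@log_head R) s - mean n (@log_head R) s -
      mean m (@log_head R) s| <= C by exists L, C.
move=> n m; rewrite mean_add; set h := mean m (@log_head R) s.
have hi : mean n (mean m (@log_head R)) s <= mean n (@log_head R) s + (h + C).
  rewrite -mean_addr; apply: mean_le => // t gt.
  rewrite (le_trans (mean_log_head_good m gt gs))// /C -/h.
  by have := ler_norm (N%:R * ln 2 : R); have := ler_norm (- log_head s);
    rewrite normrN; lra.
have lo : mean n (@log_head R) s + (h - C) <= mean n (mean m (@log_head R)) s.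
  rewrite -mean_addr; apply: mean_le => // t gt.
  have := mean_log_head_good m gs gt; rewrite /C -/h.
  by have := ler_norm (N%:R * ln 2 : R); have := ler_norm (log_head s); lra.
by rewrite ler_norml; apply/andP; split; lra.
Qed.

End mean.
End states.

(** * Law of the draws *)

Lemma binomial_pmf_sum1 (R : realType) (N : nat) (p : R) :
  \sum_(a < N.+1) binomial_pmf N p a = 1.
Proof.
rewrite /binomial_pmf.
under eq_bigr do rewrite mulrC.
rewrite -exprDn_comm; last exact: mulrC.
by rewrite addrC unstable.add_onemK expr1n.
Qed.

Section words.
Context (d : measure_display) (T : measurableType d) (R : realType)
  (P : probability T R) (N : nat) (p : R) (theta : nat -> {RV P >-> nat}).
Context (p01 : 0 < p < 1)
  (theta_indep : mutually_independent [set n | (N.+2 <= n)%N] theta)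
  (theta_binomial : forall n, (N.+2 <= n)%N ->
    forall A : set nat, distribution P (theta n) A = binomial_prob N p A).

Let b := binomial_pmf N p.

(** The first draw that the recursion uses is [theta N.+2]. *)
Definition word (m : nat) (t : T) : seq nat :=
  mkseq (fun i => theta (N.+2 + i)%N t) m.

Let p01' : 0 <= p <= 1.
Proof. by case/andP: p01 => p0 p1; rewrite !ltW. Qed.

Let measurable_theta n (A : set nat) : measurable (theta n @^-1` A).
Proof. by rewrite -[_ @^-1` _]setTI; exact: measurable_funP. Qed.

Lemma probability_theta1 n a : (N.+2 <= n)%N ->
  P (theta n @^-1` [set a]) = (b a)%:E.
Proof.
move=> nN; have := theta_binomial nN [set a].
rewrite /distribution/= /pushforward => ->.
by rewrite /binomial_prob p01' esum_set1// lee_fin binomial_pmf_ge0.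
Qed.

Lemma probability_theta_gt n : (N.+2 <= n)%N ->
  P (theta n @^-1` [set a | (N < a)%N]) = 0%E.
Proof.
move=> nN; have := theta_binomial nN [set a | (N < a)%N].
rewrite /distribution/= /pushforward => ->.
rewrite /binomial_prob p01' esum1// => a /= Na.
by rewrite /binomial_pmf bin_small.
Qed.

Lemma word_preimage m (l : seq nat) : size l = m ->
  word m @^-1` [set l] = \bigcap_(i in [set` [fset i in iota N.+2 m]%fset])
    (theta i @^-1` [set nth 0%N l (i - N.+2)]).
Proof.
move=> lm; apply/seteqP; split => [t /= <- i /=|t /= h].
  rewrite !inE/= mem_iota => /andP[Ni im].
  by rewrite nth_mkseq ?subnKC// ltn_subLR.
apply: (@eq_from_nth _ 0%N); rewrite size_mkseq// => i im.
rewrite nth_mkseq//; have /= := h (N.+2 + i)%N.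
by rewrite addKn; apply; rewrite !inE/= mem_iota leq_addr ltn_add2l.
Qed.

Lemma measurable_word m (l : seq nat) : size l = m ->
  measurable (word m @^-1` [set l]).
Proof.
move=> lm; rewrite word_preimage//.
by apply: bigcap_measurableType => i _; exact: measurable_theta.
Qed.

Lemma probability_word (l : seq nat) :
  P (word (size l) @^-1` [set l]) = (\prod_(a <- l) b a)%:E.
Proof.
rewrite word_preimage// theta_indep; last 2 first.
  by move=> i /=; rewrite !inE/= mem_iota => /andP[].
  by [].
rewrite (perm_big (iota N.+2 (size l)))/=; last first.
  apply: uniq_perm; [exact: fset_uniq|exact: iota_uniq|].
  by move=> i; rewrite !inE.
rewrite -[N.+2]addn0 iotaDl big_map -prodEFin [RHS](big_nth 0%N).
rewrite /index_iota subn0.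
by apply: eq_bigr => i _; rewrite probability_theta1 ?leq_addr// addn0 addKn.
Qed.

(** Induction on the number [k] of draws still to come, on the event that the first draws spell [l].
    For empty [l] this event is the whole space. *)
Lemma integral_word (s0 : seq R) (m : nat) (f : T -> \bar R) (g : seq R -> R) :
  measurable_fun [set: T] f -> (forall t, 0 <= f t)%E ->
  {ae P, forall t, f t = (g (foldl (fun s a => step N a s) s0 (word m t)))%:E} ->
  (\int[P]_t f t = (mean N b m g s0)%:E)%E.
Proof.
move=> mf f0 fg.
suff key : forall k l, (size l + k = m)%N ->
    (\int[P]_(t in word (size l) @^-1` [set l]) f t =
    ((\prod_(a <- l) b a) *
      mean N b k g (foldl (fun s a => step N a s) s0 l))%:E)%E.
  have := key m [::] erefl; rewrite big_nil mul1r => <-.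
  by congr (integral _ _ _); apply/seteqP; split.
elim => [l|k IH l].
  rewrite addn0 => lm; have ml := measurable_word (erefl (size l)).
  rewrite (@ae_eq_integral _ _ _ _ _ (cst
    (g (foldl (fun s a => step N a s) s0 l))%:E))//.
  - by rewrite integral_cst// EFinM muleC; congr (_ * _)%E; exact: probability_word.
  - exact: measurable_funS mf.
  - by apply: filterS fg => t /= ft tl; rewrite ft -lm tl.
rewrite addnS -addSn => lm.
(* A next draw above [N] has probability zero; off this event, the event of [l] splits into those of
   its [N.+1] one-letter extensions. *)
set B := theta (N.+2 + size l)%N @^-1` [set a | (N < a)%N].
set F := fun a : nat => word (size l).+1 @^-1` [set rcons l a].
have mF a : measurable (F a) by apply: measurable_word; rewrite size_rcons.
have EB : word (size l) @^-1` [set l] `\` B =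
    \big[setU/set0]_(a <- index_iota 0 N.+1) F a.
  rewrite -bigcup_seq; apply/seteqP; split => [t [/= tl tB]|t [a /= aN]].
    exists (theta (N.+2 + size l)%N t) => /=.
      by rewrite mem_index_iota/= ltnS leqNgt; apply/negP.
    by rewrite /F/= /word mkseqS -/(word _ _) tl.
  rewrite /F/= /word mkseqS => /eqP; rewrite eqseq_rcons => /andP[/eqP tl /eqP ta].
  split => //=; rewrite /B/= ta => Na.
  by move: aN; rewrite mem_index_iota/= ltnS leqNgt Na.
rewrite (ge0_negligible_integral (N := B))//; last 4 first.
- exact: measurable_theta.
- exact: measurable_word.
- exact: measurable_funS mf.
- by apply: probability_theta_gt; exact: leq_addr.
rewrite EB ge0_integral_bigsetU//; last 3 first.
- exact: iota_uniq.
- apply/trivIsetP => i j _ _ ij; rewrite /F -preimage_setI.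
  rewrite (_ : _ `&` _ = set0) ?preimage_set0//.
  apply/seteqP; split => // l' [/= -> /eqP]; rewrite eqseq_rcons eqxx/=.
  by rewrite (negbTE ij).
- by apply: measurable_funS mf => //; rewrite -EB; apply: measurableT.
have IHF a : (\int[P]_(t in F a) f t = ((\prod_(c <- l) b c) * (b a *
    mean N b k g (step N a (foldl (fun s c => step N c s) s0 l))))%:E)%E.
  have := IH (rcons l a); rewrite size_rcons => /(_ lm) ->.
  by rewrite -cats1 big_cat big_seq1 foldl_cat/= mulrA.
rewrite (eq_bigr _ (fun a _ => IHF a)).
by rewrite sumEFin big_mkord/= big_distrr.
Qed.

End words.

(** * Properties of a single path *)

Fixpoint history (R : realType) (x : nat -> R) (n : nat) : seq R :=
  if n is m.+1 then x n :: history x m else [:: x 0%N].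

Section paths.
Context (R : realType) (N : nat).
Implicit Types (x : nat -> R) (th : nat -> nat).

Lemma nth_history x n i : (i <= n)%N -> (history x n)`_i = x (n - i)%N.
Proof. by elim: n i => [|n IH] [|i] //= iN; rewrite ?subn0 ?subSS ?IH. Qed.

Lemma BF_foldl th x m : BF_recursion N th x ->
  (forall n, (N.+2 <= n)%N -> (th n <= N)%N) ->
  history x (N.+1 + m) = foldl (fun s a => step N a s) (history x N.+1)
    (mkseq (fun i => th (N.+2 + i)%N) m).
Proof.
move=> [_ _ _ rec] thN; elim: m => [|m IH]; first by rewrite addn0.
rewrite mkseqS foldl_rcons -IH addnS.
have : (N.+1 <= N.+1 + m)%N := leq_addr _ _.
have : (th (N.+1 + m).+1 <= N)%N by apply: thN; rewrite ltnS leq_addr.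
rewrite -[(N.+2 + m)%N]/(N.+1 + m).+1; move: (N.+1 + m)%N => n a nN.
(* As [a <= N], the index [n + a - N] equals [n - (N - a)], which is that of entry [N - a] of the
   history. *)
rewrite /step /= rec// !nth_history ?subn0//; last by lia.
by congr (_ + x _ :: _); lia.
Qed.

Lemma BF_initial th x n : BF_recursion N th x ->
  (n <= N.+1)%N -> x n = (fib n.+1)%:R.
Proof.
move=> [x0 x1 rec _]; suff h : forall k, ((k <= N.+1)%N -> x k = (fib k.+1)%:R) /\
    ((k.+1 <= N.+1)%N -> x k.+1 = (fib k.+2)%:R) by exact: (h n).1.
elim=> [|k [IH1 IH2]]; first by rewrite x0 x1.
split=> // kN; rewrite rec ?kN//= IH2 ?IH1//; [|by lia..].
by rewrite -natrD.
Qed.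

(** Defined from Fibonacci numbers and not from a path, so that one starting state serves all
    probability spaces. *)
Definition initial_state : seq R := history (fun i => (fib i.+1)%:R) N.+1.

Lemma BF_history_initial th x : BF_recursion N th x ->
  history x N.+1 = initial_state.
Proof.
move=> rec; rewrite /initial_state.
have : (N.+1 <= N.+1)%N by []; elim: {-2}N.+1 => [|k IH] kN /=.
  by rewrite (BF_initial rec).
by rewrite IH ?(BF_initial rec)// ltnW.
Qed.

Lemma fib_gt0 n : (0 < fib n.+1)%N.
Proof. by elim: n => // n IH; rewrite [fib _]/= -/(fib n.+1) addn_gt0 IH. Qed.

Lemma leq_fib n : (fib n.+1 <= fib n.+2)%N.
Proof. exact: leq_addr. Qed.

Lemma leq_fib_double n : (fib n.+2 <= 2 * fib n.+1)%N.
Proof.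
rewrite mul2n -addnn leq_add2l; case: n => // n; exact: leq_fib.
Qed.

Lemma good_initial_state : good N initial_state.
Proof.
split=> i iN; rewrite !nth_history//; do ?by lia.
  by rewrite ltr0n fib_gt0.
have -> : (N.+1 - i.+1 = (N - i).-1.+1)%N by lia.
have -> : (N.+1 - i = (N - i).-1.+2)%N by lia.
by rewrite -natrM !ler_nat leq_fib leq_fib_double.
Qed.

Lemma BF_bounds th x : BF_recursion N th x ->
  (forall n, (N.+2 <= n)%N -> (th n <= N)%N) ->
  forall n, 1 <= x n /\ x n <= x n.+1 <= 2 * x n.
Proof.
move=> [x0 x1 rec1 rec2] thN.
suff h : forall n, (forall i, (i <= n)%N -> 1 <= x i <= x n) /\
    (forall i, (i < n)%N -> x i <= x i.+1 <= 2 * x i).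
  move=> n; split; first by have /andP[] := (h n).1 n (leqnn n).
  exact: (h n.+1).2.
elim=> [|n [IH1 IH2]].
  by split => // -[]// _; rewrite x0 lexx.
(* Both regimes of the recursion add an earlier term; only the step from [x 0] to [x 1] does not. *)
have [j jn xn] : exists2 j, (j <= n)%N & x n.+1 = x n + x j \/ n = 0%N.
  have [nN|Nn] := leqP n N.
    case: n {IH1 IH2} nN => [|n] nN; first by exists 0%N => //; right.
    by exists n => //; left; apply: rec1.
  exists (n + th n.+1 - N)%N; last by left; apply: rec2.
  by have := thN n.+1 Nn; lia.
have /andP[xn1 _] := IH1 n (leqnn n).
have hx : x n <= x n.+1 <= 2 * x n.
  case: xn => [->|->]; last by rewrite x0 x1; apply/andP; split; lra.
  by have /andP[h1 h2] := IH1 j jn; apply/andP; split; lra.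
have /andP[hx1 hx2] := hx.
split=> i.
  rewrite leq_eqVlt => /predU1P[->|]; first by apply/andP; split; lra.
  by rewrite ltnS => /IH1 /andP[-> h]; rewrite (le_trans h).
by rewrite ltnS leq_eqVlt => /predU1P[->//|/IH2].
Qed.

Lemma le_BF th x : BF_recursion N th x ->
  (forall n, (N.+2 <= n)%N -> (th n <= N)%N) ->
  {homo (fun n => ln (x n)) : m n / (m <= n)%N >-> m <= n}.
Proof.
move=> rec thN; apply: homo_leq => [//|y z u|n]; first exact: le_trans.
have [x1 /andP[h _]] := BF_bounds rec thN n.
by rewrite ler_ln ?posrE//; lra.
Qed.

Lemma ln_BF_bounds th x n : BF_recursion N th x ->
  (forall n, (N.+2 <= n)%N -> (th n <= N)%N) ->
  0 <= ln (x n) <= n%:R * ln 2.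
Proof.
move=> rec thN; have b := BF_bounds rec thN.
rewrite ln_ge0 ?(b n).1//=; elim: n => [|n IH].
  by case: rec => -> _ _ _; rewrite ln1 mul0r.
have [x1 /andP[h1 h2]] := b n.
have x0 : 0 < x n by lra.
rewrite -natr1 mulrDl mul1r; apply: (le_trans _ (lerD IH (lexx _))).
rewrite -lnM ?posrE//; rewrite ler_ln ?posrE ?mulr_gt0//; lra.
Qed.

End paths.

(** * From second moments to convergence *)

Lemma exists_sqrt_floor n : exists k, (k ^ 2 <= n < k.+1 ^ 2)%N.
Proof.
elim: n => [|n [k /andP[k1 k2]]]; first by exists 0%N.
have [h|h] := ltnP n.+1 (k.+1 ^ 2); first by exists k; lia.
by exists k.+1; rewrite h /=; lia.
Qed.

(* For [k ^ 2 <= n < (k + 1) ^ 2], monotonicity squeezes [z n] between values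
   of [z] at consecutive squares. *)
Lemma cvg_average_squares (R : realType) (z : nat -> R) (L : R) :
  {homo z : m n / (m <= n)%N >-> m <= n} ->
  z (k ^ 2)%N / (k ^ 2)%:R @[k --> \oo] --> L ->
  z n / n%:R @[n --> \oo] --> L.
Proof.
move=> zm /cvgrPdist_le hz; apply/cvgrPdist_le => e e0.
(* Moving from [n] to a neighbouring square changes [n * L] by at most [3 * f * n]; the error [f] at
   [(k + 1) ^ 2 <= 4 * k ^ 2] costs at most [4 * f * n]. *)
have [f [f0 ef]] : exists f, 0 < f /\ e = 7 * f.
  by exists (e / 7); split; [rewrite divr_gt0|field].
have [K _ hK] := hz _ f0.
(* The second bound ensures [|L| <= k * f]. *)
pose K' := maxn K.+1 (Num.truncn (`|L| / f)).+1.
exists (K' ^ 2)%N => // n /= Kn.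
have [k /andP[k1 k2]] := exists_sqrt_floor n.
have Kk : (K' <= k)%N by rewrite -ltnS -ltn_sqr; exact: leq_ltn_trans k2.
have [Kk1 Kk2] : (K < k)%N /\ (Num.truncn (`|L| / f) < k)%N.
  by move: Kk; rewrite geq_max => /andP[].
have k0 : (0 < k)%N by exact: leq_ltn_trans Kk1.
have n0 : (0 < n)%N by apply: leq_trans k1; rewrite expn_gt0 k0.
have Lk : `|L| <= k%:R * f.
  rewrite -ler_pdivrMr// (le_trans (ltW (truncnS_gt _)))// ler_nat//.
have := hK k (ltnW Kk1); have := hK k.+1 (leqW (ltnW Kk1)).
have := zm _ _ k1; have := zm _ _ (ltnW k2).
have : (k ^ 2)%:R <= n%:R :> R by rewrite ler_nat.
have : n%:R <= (k.+1 ^ 2)%:R :> R by rewrite ler_nat ltnW.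
have k20 : 0 < (k ^ 2)%:R :> R by rewrite ltr0n expn_gt0 k0.
have k20' : 0 < (k.+1 ^ 2)%:R :> R by rewrite ltr0n.
have n0' : 0 < n%:R :> R by rewrite ltr0n.
rewrite /= !ler_distlC !ler_pdivlMr// !ler_pdivrMr// !natrX -natr1 ef.
have : 1 <= k%:R :> R by rewrite ler1n.
have := ler_norm L; have := ler_norm (- L); rewrite normrN.
move: (`|L|) (k%:R) (n%:R) Lk (z n) (z _) (z _).
move=> A kk nn Lk zn u v AL1 AL2 kk1 nk1 nk2 zu zv /andP[_ hu] /andP[hv _].
have hA : (2 * kk + 1) * A <= 3 * f * nn.
  have : (2 * kk + 1) * A <= 3 * kk * (kk * f).
    apply: ler_pM => //; lra.
  have : f * kk ^+ 2 <= f * nn by rewrite ler_pM2l.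
  by move=> ? ?; lra.
have hf : f * kk ^+ 2 <= f * nn by rewrite ler_pM2l.
have hkk : f * kk <= f * kk ^+ 2 by rewrite ler_pM2l// expr2 ler_peMl//; lra.
have hkf : f * 1 <= f * kk by rewrite ler_pM2l.
have A0 : 0 <= A by lra.
have d1 : ((kk + 1) ^+ 2 - nn) * L <= (2 * kk + 1) * A.
  apply: (@le_trans _ _ (((kk + 1) ^+ 2 - nn) * A)).
    by apply: ler_wpM2l; lra.
  by apply: ler_wpM2r; lra.
have d2 : (nn - kk ^+ 2) * L <= (2 * kk + 1) * A.
  apply: (@le_trans _ _ ((nn - kk ^+ 2) * A)).
    by apply: ler_wpM2l; lra.
  by apply: ler_wpM2r; lra.
by apply/andP; split; lra.
Qed.

Section second_moment.
Context (d : measure_display) (T : measurableType d) (R : realType)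
  (P : probability T R).
Implicit Types (Z f : nat -> T -> R) (L A B : R).

Lemma integral_probability_cst (c : R) : (\int[P]__ c%:E = c%:E)%E.
Proof.
rewrite integral_cst// -[RHS]mule1; congr (_ * _)%E; exact: probability_setT.
Qed.

(** By monotone convergence the sum of the [f n] is integrable, hence finite almost everywhere, so
    its terms tend to zero. *)
Lemma ae_cvg0_of_integral_series f (M : R) :
  (forall n, measurable_fun [set: T] (f n)) -> (forall n t, 0 <= f n t) ->
  (forall n, \sum_(0 <= i < n) \int[P]_t (f i t)%:E <= M%:E)%E ->
  \forall t \ae P, f n t @[n --> \oo] --> 0.
Proof.
move=> mf f0 fM.
have mEf n : measurable_fun [set: T] (EFin \o f n) by exact/measurable_EFinP.
have sf0 t : (0 <= \sum_(0 <= n <oo) (f n t)%:E)%E.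
  by apply: nneseries_ge0 => n _ _; rewrite lee_fin.
have : P.-integrable setT (fun t => \sum_(0 <= n <oo) (f n t)%:E)%E.
  apply/integrableP; split.
    by apply: ge0_emeasurable_sum => [k t _ _|k _] /=; [rewrite lee_fin|exact: mEf].
  rewrite (eq_integral (fun t => \sum_(0 <= n <oo) (f n t)%:E)%E); last first.
    by move=> t _; rewrite gee0_abs.
  rewrite integral_nneseries//; last by move=> *; rewrite lee_fin.
  apply: (@le_lt_trans _ _ M%:E); last exact: ltry.
  apply: lime_le; last exact: nearW.
  by apply: is_cvg_nneseries => n _ _; apply: integral_ge0 => t _; rewrite lee_fin.
move=> /(integrable_ae measurableT); apply: filterS => t /(_ I) ft.
apply: cvg_series_cvg_0; apply: nondecreasing_is_cvgn.
  exact: nondecreasing_series.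
exists (fine (\sum_(0 <= n <oo) (f n t)%:E)) => _ [n _ <-].
rewrite -lee_fin fineK// -sumEFin; apply: nneseries_lim_ge => k _ _.
by rewrite lee_fin.
Qed.

Lemma integral_sqr_average Z L A n : (0 < n)%N ->
  measurable_fun [set: T] (Z n) ->
  (\int[P]_t ((Z n t - n%:R * L) ^+ 2)%:E <= (n%:R * A)%:E)%E ->
  (\int[P]_t ((Z n t / n%:R - L) ^+ 2)%:E <= (A / n%:R)%:E)%E.
Proof.
move=> n0 mZ ZA; have n0' : n%:R != 0 :> R by rewrite pnatr_eq0 -lt0n.
have -> : (\int[P]_t ((Z n t / n%:R - L) ^+ 2)%:E =
    (n%:R ^- 2)%:E * \int[P]_t ((Z n t - n%:R * L) ^+ 2)%:E)%E.
  rewrite -ge0_integralZl//.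
  - by apply: eq_integral => t _; rewrite -EFinM; congr EFin; field.
  - apply/measurable_EFinP/measurable_funX/measurable_funB => //.
  - by move=> t _; rewrite lee_fin sqr_ge0.
have n2 : (0 <= (n%:R ^- 2)%:E :> \bar R)%E by rewrite lee_fin invr_ge0 exprn_ge0.
apply: (le_trans (lee_wpmul2l n2 ZA)).
by rewrite -EFinM lee_fin le_eqVlt; apply/orP; left; apply/eqP; field.
Qed.

Lemma ae_cvg_average Z L A (n0 : nat) : 0 <= A ->
  (forall n, measurable_fun [set: T] (Z n)) ->
  (forall n, (n0 <= n)%N ->
    \int[P]_t ((Z n t - n%:R * L) ^+ 2)%:E <= (n%:R * A)%:E)%E ->
  (\forall t \ae P, {homo Z ^~ t : m n / (m <= n)%N >-> m <= n}) ->
  \forall t \ae P, Z n t / n%:R @[n --> \oo] --> L.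
Proof.
(* The shift keeps [q k] above [n0] and at least [(k + 1) * (k + 2)], so the bounds [A / q k] are
   dominated by a telescoping series. *)
move=> A0 mZ ZA Zm; pose q k := ((k + n0.+2) ^ 2)%N.
have qn k : (n0 <= q k)%N by rewrite /q; nia.
have q0 k : (0 < q k)%N by rewrite /q expn_gt0 addnS.
have := @ae_cvg0_of_integral_series
  (fun k t => (Z (q k) t / (q k)%:R - L) ^+ 2) A.
have mf k : measurable_fun [set: T] (fun t => (Z (q k) t / (q k)%:R - L) ^+ 2).
  by apply/measurable_funX/measurable_funB => //; apply: measurable_funM.
move=> /(_ mf (fun k t => sqr_ge0 _)) h.
have {}h : \forall t \ae P, (Z (q k) t / (q k)%:R - L) ^+ 2 @[k --> \oo] --> 0.
  apply: h => n.
  apply: (@le_trans _ _ (\sum_(0 <= k < n)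
      (A * (k.+1%:R^-1 - k.+2%:R^-1))%:E)%E).
    apply: lee_sum => k _.
    rewrite (le_trans (integral_sqr_average _ _ (ZA _ _)))// lee_fin.
    rewrite ler_wpM2l//.
    have -> : k.+1%:R^-1 - k.+2%:R^-1 = (k.+1%:R * k.+2%:R)^-1 :> R.
      by field; rewrite -natrD nat1r !pnatr_eq0.
    rewrite lef_pV2 ?posrE ?mulr_gt0 ?ltr0n//.
    by rewrite -natrM ler_nat /q; nia.
  rewrite sumEFin lee_fin -big_distrr/= -[leRHS]mulr1 ler_wpM2l//.
  have -> : \sum_(0 <= k < n) (k.+1%:R^-1 - k.+2%:R^-1) = 1 - n.+1%:R^-1 :> R.
    elim: n => [|n IH]; first by rewrite big_geq// invr1 subrr.
    by rewrite big_nat_recr//= IH; ring.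
  by rewrite lerBlDr lerDl invr_ge0.
apply: filterS2 Zm h => t Zt h; apply: cvg_average_squares => //.
rewrite -(cvg_shiftn n0.+2); apply/cvgrPdist_le => e e0.
have e20 : 0 < e ^+ 2 by rewrite exprn_gt0.
have /cvgrPdist_le/(_ _ e20) := h; apply: filterS => k.
rewrite sub0r normrN ger0_norm ?sqr_ge0//= -/(q k) distrC => hk.
by rewrite -(@ler_pXn2r _ 2) ?nnegrE ?(ltW e0)// real_normK ?num_real.
Qed.

(** The bound [B] gives integrability for every [n], including those below [n0]; the second moments
    give the convergence. *)
Lemma cvg_L1_average Z L A B (n0 : nat) : 0 <= A ->
  (forall n, measurable_fun [set: T] (Z n)) ->
  (forall n, (n0 <= n)%N ->
    \int[P]_t ((Z n t - n%:R * L) ^+ 2)%:E <= (n%:R * A)%:E)%E ->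
  (forall n, \forall t \ae P, `|Z n t / n%:R| <= B) ->
  cvg_L1 P (fun n t => Z n t / n%:R) L.
Proof.
move=> A0 mZ ZA ZB.
have mY n : measurable_fun [set: T] (fun t => Z n t / n%:R).
  by apply: measurable_funM.
split=> [n|].
  apply/Lfun1_integrable/integrableP; split; first exact/measurable_EFinP.
  apply: (@le_lt_trans _ _ (\int[P]_t (`|B|)%:E)%E); last first.
    by rewrite integral_probability_cst ltry.
  apply: ae_ge0_le_integral => //.
    by apply: measurableT_comp => //; apply/measurable_EFinP.
  by apply: filterS (ZB n) => t h _; rewrite /= lee_fin (le_trans h)// ler_norm.
suff key e : 0 < e -> \forall n \near \oo,
    ('N[P]_1[EFin \o ((fun t => Z n t / n%:R) \- cst L)%R] <= e%:E)%E.
  apply/fine_cvgP; split.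
    apply: filterS (key 1 ltr01) => n h.
    by rewrite ge0_fin_numE ?Lnorm_ge0// (le_lt_trans h)// ltry.
  apply/cvgrPdist_le => e e0; apply: filterS (key e e0) => n h.
  rewrite sub0r normrN ger0_norm ?fine_ge0 ?Lnorm_ge0//= -lee_fin fineK//.
  by rewrite ge0_fin_numE ?Lnorm_ge0// (le_lt_trans h)// ltry.
move=> e0; pose f := e / 2; have f0 : 0 < f by rewrite divr_gt0.
(* Beyond this rank the mean square error [A / n] is at most [f ^+ 2]. *)
exists (maxn n0.+1 (Num.truncn (A / f ^+ 2)).+1) => // n /=.
rewrite geq_max => /andP[n0n An].
have n_gt0 : (0 < n)%N by exact: leq_ltn_trans n0n.
have {}An : A <= n%:R * f ^+ 2.
  by rewrite -ler_pdivrMr ?exprn_gt0// (le_trans (ltW (truncnS_gt _)))// ler_nat.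
have mW : measurable_fun [set: T] (fun t => ((Z n t / n%:R - L) ^+ 2)%:E).
  exact/measurable_EFinP/measurable_funX/measurable_funB.
have mfW : measurable_fun [set: T]
    (fun t => (f^-1)%:E * ((Z n t / n%:R - L) ^+ 2)%:E)%E.
  exact: measurable_funeM.
rewrite Lnorm1.
(* Pointwise [|y| <= f + y ^+ 2 / f], and each of the two terms integrates to at most
   [f = e / 2]. *)
apply: (@le_trans _ _ (\int[P]_t (f%:E +
    (f^-1)%:E * ((Z n t / n%:R - L) ^+ 2)%:E))%E).
  apply: ge0_le_integral => //.
  - apply/measurableT_comp/measurable_EFinP/measurable_funB => //.
  - exact: emeasurable_funD.
  - move=> t _ /=; rewrite -EFinM -EFinD lee_fin.
    rewrite -real_normK ?num_real//; set y := `|_|.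
    rewrite -(ler_pM2l f0) mulrDr mulrA divff ?gt_eqF// mul1r.
    by have := sqr_ge0 (y - f); have := normr_ge0 (Z n t / n%:R - L);
      rewrite -/y; nra.
rewrite ge0_integralD//; first last.
- by move=> t _; rewrite -EFinM lee_fin mulr_ge0 ?sqr_ge0// invr_ge0 ltW.
- by move=> t _; rewrite lee_fin ltW.
rewrite integral_probability_cst ge0_integralZl//; first last.
- by rewrite lee_fin invr_ge0 ltW.
- by move=> t _; rewrite lee_fin sqr_ge0.
have f1 : (0 <= (f^-1)%:E :> \bar R)%E by rewrite lee_fin invr_ge0 ltW.
have := lee_wpmul2l f1 (integral_sqr_average n_gt0 (mZ n) (ZA n (ltnW n0n))).
move=> /(leeD2l f%:E).
move=> /le_trans; apply; rewrite -EFinM -EFinD lee_fin.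
have -> : e = f + f by rewrite /f -splitr.
rewrite lerD2l mulrC !ler_pdivrMr ?ltr0n//.
by move: An; lra.
Qed.

End second_moment.

(** * Moments and convergence for Binomial-Fibonacci sequences *)

Section binomial_fibonacci_moments.
Context (d : measure_display) (T : measurableType d) (R : realType)
  (P : probability T R) (N : nat) (p : R) (theta : nat -> {RV P >-> nat})
  (X : nat -> {RV P >-> R}).
Context (p01 : 0 < p < 1) (BF : binomial_fibonacci N p theta X).

Lemma ae_theta_le :
  \forall t \ae P, forall n, (N.+2 <= n)%N -> (theta n t <= N)%N.
Proof.
have [_ theta_binomial _] := BF.
apply: ae_foralln => n; have [Nn|nN] := leqP N.+2 n; last first.
  by apply: filterE => t.
exists (theta n @^-1` [set a | (N < a)%N]); split.
- by rewrite -[_ @^-1` _]setTI; exact: measurable_funP.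
- exact: (probability_theta_gt p01 theta_binomial).
- by move=> t /= h; rewrite ltnNge; apply/negP => tN; exact: h.
Qed.

Lemma ae_ln_BF : \forall t \ae P,
  {homo (fun n => ln (X n t)) : m n / (m <= n)%N >-> m <= n} /\
  forall n, 0 <= ln (X n t) <= n%:R * ln 2.
Proof.
have [_ _ rec] := BF; apply: filterS2 rec ae_theta_le => t rec tN.
split; first exact: le_BF rec tN.
by move=> n; exact: ln_BF_bounds rec tN.
Qed.

Lemma measurable_ln_BF n : measurable_fun [set: T] (fun t => ln (X n t)).
Proof. exact: (measurableT_comp (@measurable_ln R)). Qed.

(** Only [m = n - N.+1] steps are random, so centring at [n * L] instead of [m * L] adds
    [N.+1 * |L|] to the bias. The squared bias is absorbed into the factor [n >= 1]. *)
Lemma integral_ln_BF_sqr (L C : R) :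
  (forall m, `|mean N (binomial_pmf N p) m (@log_head R) (initial_state R N)
    - m%:R * L| <= C) ->
  forall n, (N.+1 <= n)%N ->
  (\int[P]_t ((ln (X n t) - n%:R * L) ^+ 2)%:E <=
    (n%:R * (ln 2 ^+ 2 + (C + N.+1%:R * `|L|) ^+ 2))%:E)%E.
Proof.
move=> LC n /subnKC <-; move: (n - N.+1)%N => m {n}.
have [indep theta_binomial rec] := BF.
have p01' : 0 <= p <= 1 by case/andP: p01 => p0 p1; rewrite !ltW.
rewrite (integral_word p01 indep theta_binomial (s0 := initial_state R N)
  (m := m) (g := fun s => (log_head s - (N.+1 + m)%:R * L) ^+ 2)); first last.
- apply: filterS2 rec ae_theta_le => t rec tN; congr (_%:E).
  rewrite -(BF_history_initial rec) -(BF_foldl m rec tN) /log_head.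
  by rewrite nth_history// subn0.
- by move=> t; rewrite lee_fin sqr_ge0.
- apply/measurable_EFinP/measurable_funX/measurable_funB => //.
  exact: measurable_ln_BF.
rewrite lee_fin (le_trans (mean_log_head_sqr _ (binomial_pmf_sum1 N p) _ _ _))//.
- by move=> a; exact: binomial_pmf_ge0.
- exact: good_initial_state.
set h := mean _ _ _ _ _.
have hC : `|h - (N.+1 + m)%:R * L| <= C + N.+1%:R * `|L|.
  have -> : h - (N.+1 + m)%:R * L = (h - m%:R * L) - N.+1%:R * L.
    by rewrite natrD; ring.
  rewrite (le_trans (ler_normB _ _))// normrM normr_nat lerD2r; exact: LC.
rewrite mulrDr; apply: lerD.
  by rewrite ler_wpM2r ?sqr_ge0// ler_nat leq_addl.
apply: (@le_trans _ _ (1 * (C + N.+1%:R * `|L|) ^+ 2)).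
  by rewrite mul1r -[leLHS]real_normK ?num_real// ler_pXn2r// nnegrE (le_trans _ hC).
by rewrite ler_wpM2r ?sqr_ge0// ler1n.
Qed.

Lemma BF_cvg (L C : R) :
  (forall m, `|mean N (binomial_pmf N p) m (@log_head R) (initial_state R N)
    - m%:R * L| <= C) ->
  (\forall t \ae P, ln (X n t) / n%:R @[n --> \oo] --> L) /\
  cvg_L1 P (fun n t => ln (X n t) / n%:R) L.
Proof.
move=> /integral_ln_BF_sqr XA.
have A0 : 0 <= ln 2 ^+ 2 + (C + N.+1%:R * `|L|) ^+ 2 by rewrite addr_ge0 ?sqr_ge0.
split.
  apply: (ae_cvg_average A0 measurable_ln_BF XA).
  by apply: filterS ae_ln_BF => t [].
apply: (cvg_L1_average (B := ln 2) A0 measurable_ln_BF XA) => n.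
apply: filterS ae_ln_BF => t [_ /(_ n)/andP[h0 h]].
(* For [n = 0] the quotient is [0], since the inverse of [0] is [0]. *)
case: n h0 h => [|n] h0 h; first by rewrite invr0 mulr0 normr0 ln_ge0// ler1n.
by rewrite ger0_norm ?divr_ge0// ler_pdivrMr ?ltr0n// mulrC.
Qed.

End binomial_fibonacci_moments.

(** * The Bernoulli case *)

Section bernoulli.
Context (R : realType) (p : R) (p01 : 0 < p < 1).
Let q := 1 - p.
Local Notation ell := (log_fib_ratio R).

Let p_gt0 : 0 < p. Proof. by case/andP: p01. Qed.
Let q_gt0 : 0 < q. Proof. by case/andP: p01; rewrite subr_gt0. Qed.

Lemma log_fib_ratioE k : ell k = ln ((fib k.+3)%:R / (fib k.+2)%:R).
Proof. by rewrite /log_fib_ratio addn2 addn3. Qed.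

Lemma log_fib_ratio_ge0 k : 0 <= ell k.
Proof.
rewrite log_fib_ratioE ln_ge0// ler_pdivlMr ?ltr0n ?fib_gt0//.
by rewrite mul1r ler_nat leq_fib.
Qed.

Lemma log_fib_ratio_le k : ell k <= ln 2.
Proof.
rewrite log_fib_ratioE ler_ln ?posrE ?divr_gt0 ?ltr0n ?fib_gt0//.
by rewrite ler_pdivrMr ?ltr0n ?fib_gt0// -natrM ler_nat leq_fib_double.
Qed.

Let tail k j := q ^+ j * ell (k + j).

Let tail_ge0 k j : 0 <= tail k j.
Proof. by rewrite mulr_ge0 ?exprn_ge0 ?log_fib_ratio_ge0// ltW. Qed.

Let tail_le k j : tail k j <= geometric (ln 2) q j.
Proof.
by rewrite /tail /= mulrC ler_wpM2r ?exprn_ge0 ?log_fib_ratio_le// ltW.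
Qed.

Let cvg_geo : series (geometric (ln 2) q) @ \oo --> ln 2 / p.
Proof.
have -> : ln 2 / p = ln 2 * (1 - q)^-1 :> R by rewrite /q opprB addrCA subrr addr0.
by apply: cvg_geometric_series; rewrite gtr0_norm// /q ltrBlDl ltrDr.
Qed.

Let geo_ge0 j : 0 <= geometric (ln 2) q j :> R.
Proof. exact: le_trans (tail_le 0 j). Qed.

Lemma cvg_discounted k : cvgn (series (tail k)).
Proof.
apply: (@series_le_cvg _ _ (geometric (ln 2) q)) => //.
by apply/cvg_ex; exists (ln 2 / p).
Qed.

(* Started from a pair of consecutive terms with ratio [F_(k+3) / F_(k+2)],
   [log_head s + discounted k - ell k - m * (p * discounted 0)] is a martingale
   in the number [m] of steps. *)
Definition discounted k : R := limn (series (tail k)).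

(** For [h k = discounted k - ell k] this gives [h k = q * discounted k.+1]. As
    [ell + h = discounted], its average after one draw is [h k + p * discounted 0], which is the
    Poisson equation. *)
Lemma discounted_rec k : discounted k = ell k + q * discounted k.+1.
Proof.
rewrite /discounted.
have h : series (tail k) n.+1 @[n --> \oo] --> ell k + q * limn (series (tail k.+1)).
  have -> : (fun n => series (tail k) n.+1) =
      (fun n => ell k + q * series (tail k.+1) n).
    apply/funext => n; rewrite /series/= big_nat_recl//= /tail expr0 mul1r addn0.
    congr (_ + _); rewrite big_distrr/=; apply: eq_bigr => i _.
    by rewrite exprS addSnnS mulrA.
  apply: cvgD; first exact: cvg_cst.
  apply: cvgMl_tmp; exact: cvg_discounted.
apply/cvg_lim => //.
by move: h; rewrite (_ : (fun n => _) = [sequence series (tail k) (n + 1)%N]_n)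
  ?cvg_shiftn//; apply/funext => n /=; rewrite addn1.
Qed.

Lemma discounted_ge0 k : 0 <= discounted k.
Proof.
apply: limr_ge; first exact: cvg_discounted.
by apply: nearW => n; apply: sumr_ge0.
Qed.

Lemma discounted_le k : discounted k <= ln 2 / p.
Proof.
rewrite -(cvg_lim _ cvg_geo)//; apply: ler_lim; first exact: cvg_discounted.
  by apply/cvg_ex; exists (ln 2 / p).
by apply: nearW => n; apply: ler_sum => i _; exact: tail_le.
Qed.

(** For [m = 0] the error is [- q * discounted k.+1]. Each further draw averages the errors with
    weights [q] and [p], so the bound persists. *)
Lemma mean_log_head_bernoulli m k (s : seq R) :
  0 < s`_1 -> 0 < s`_0 -> s`_0 / s`_1 = (fib k.+3)%:R / (fib k.+2)%:R ->
  `|mean 1 (binomial_pmf 1 p) m (@log_head R) s -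
    (log_head s + discounted k - ell k + m%:R * (p * discounted 0))|
  <= ln 2 / p.
Proof.
elim: m k s => [|m IH] k s s1 s0 sk /=.
  have := discounted_rec k; have := discounted_ge0 k; have := discounted_le k.
  have := log_fib_ratio_ge0 k; have := mulr_ge0 (ltW q_gt0) (discounted_ge0 k.+1).
  rewrite mul0r ler_norml => *; apply/andP; split; lra.
rewrite big_ord_recl big_ord1 /= -[bump 0 0]/1%N.
have -> : binomial_pmf 1 p 0 = q.
  by rewrite /binomial_pmf expr0 mul1r subn0 expr1 bin0 mulr1n.
have -> : binomial_pmf 1 p 1 = p.
  by rewrite /binomial_pmf expr1 subnn expr0 mulr1 binn mulr1n.
have f2 : 0 < (fib k.+2)%:R :> R by rewrite ltr0n fib_gt0.
have f3 : 0 < (fib k.+3)%:R :> R by rewrite ltr0n fib_gt0.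
(* Draw [0] adds the previous term and moves [k] to [k.+1]; draw [1] doubles the head, so the ratio
   becomes [2] and the index [0]. *)
have ratio0 : (s`_0 + s`_1) / s`_0 = (fib k.+4)%:R / (fib k.+3)%:R.
  have -> : fib k.+4 = (fib k.+3 + fib k.+2)%N by [].
  rewrite natrD !mulrDl !divff ?gt_eqF//; congr (1 + _).
  by rewrite -[LHS]invrK invf_div sk invf_div.
have ratio1 : (s`_0 + s`_0) / s`_0 = (fib 3)%:R / (fib 2)%:R.
  by rewrite mulrDl !divff ?gt_eqF//= divr1.
have head0 : log_head (step 1 0 s) = log_head s + ell k.+1.
  rewrite log_fib_ratioE -ratio0 -lnM ?posrE ?divr_gt0 ?addr_gt0//.
  by rewrite mulrCA divff ?gt_eqF// mulr1.
have head1 : log_head (step 1 1 s) = log_head s + ell 0.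
  rewrite log_fib_ratioE -ratio1 -lnM ?posrE ?divr_gt0 ?addr_gt0//.
  by rewrite mulrCA divff ?gt_eqF// mulr1.
have := IH k.+1 (step 1 0 s) s0 (addr_gt0 s0 s1) ratio0.
have := IH 0%N (step 1 1 s) s0 (addr_gt0 s0 s0) ratio1.
rewrite head0 head1 (discounted_rec k) -(natr1 m).
set u := mean _ _ _ _ _; set v := mean _ _ _ _ _.
set B := ln 2 / p; set D0 := discounted 0; set D1 := discounted k.+1.
move=> hu hv.
set eu := u - _ in hu; set ev := v - _ in hv.
rewrite [X in `|X|](_ : _ = q * ev + p * eu); last by rewrite /eu /ev /q; ring.
rewrite (le_trans (ler_normD _ _))// !normrM (gtr0_norm p_gt0) (gtr0_norm q_gt0).
have -> : B = q * B + p * B by rewrite /q; ring.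
by rewrite lerD// ler_pM2l.
Qed.

Lemma series_log_fib_ratio :
  series (fun k => p * q ^+ k * ell k) @ \oo --> p * discounted 0.
Proof.
have -> : series (fun k => p * q ^+ k * ell k) = (fun n => p * series (tail 0) n).
  apply/funext => n; rewrite /series/= big_distrr/=.
  by apply: eq_bigr => i _; rewrite /tail mulrA.
apply: cvgMl_tmp; exact: cvg_discounted.
Qed.

End bernoulli.

(** * Geometric expectation and conclusion *)

Lemma expectation_geometric (R : realType) (p : R) (d : measure_display)
    (T : measurableType d) (P : probability T R) (G : {RV P >-> nat})
    (f : nat -> R) (l : R) :
  geometric_rv p G -> (forall k, 0 <= f k) ->
  series (fun k => p * (1 - p) ^+ k * f k) @ \oo --> l ->
  l%:E = 'E_P[fun t => f (G t)]%E.
Proof.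
move=> geoG f0 fl; rewrite unlock.
have mG A : measurable (G @^-1` A).
  by rewrite -[_ @^-1` _]setTI; exact: measurable_funP.
have -> : [set: T] = \bigcup_k (G @^-1` [set k]).
  by apply/seteqP; split => // t _; exists (G t).
have mfG : measurable_fun [set: T] (fun t => (f (G t))%:E).
  by apply/measurable_EFinP; exact: (measurableT_comp (f := f)).
rewrite ge0_integral_bigcup//; first last.
- by move=> i j _ _ [t [/= <- <-]].
- by move=> t _; rewrite lee_fin.
- exact: measurable_funS mfG.
rewrite (eq_eseriesr (g := fun k => (p * (1 - p) ^+ k * f k)%:E)); last first.
  move=> k _.
  rewrite (eq_integral (cst (f k)%:E)); last by move=> t; rewrite inE /= => <-.
  by rewrite integral_cst// EFinM muleC; congr (_ * _)%E; exact: geoG.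
apply/esym/cvg_lim => //.
have -> : (fun n => (\sum_(0 <= k < n) (p * (1 - p) ^+ k * f k)%:E)%E) =
    EFin \o series (fun k => p * (1 - p) ^+ k * f k).
  by apply/funext => n; rewrite /= -sumEFin.
by apply: cvg_EFin; first exact: nearW.
Qed.

Theorem theorem3p1 (R : realType) (N : nat) (p : R)
    (hN : (1 <= N)%N) (hp : 0 < p < 1) :
  exists L : R,
    (forall (d : measure_display) (T : measurableType d) (P : probability T R)
        (theta : nat -> {RV P >-> nat}) (X : nat -> {RV P >-> R}),
      binomial_fibonacci N p theta X ->
      (\forall t \ae P, ln (X n t) / n%:R @[n --> \oo] --> L) /\
      cvg_L1 P (fun n t => ln (X n t) / n%:R) L) /\
    (N = 1%N ->
      (forall (d : measure_display) (T : measurableType d)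
          (P : probability T R) (G : {RV P >-> nat}),
        geometric_rv p G ->
        L%:E = 'E_P[fun t => log_fib_ratio R (G t)]%E) /\
      series (fun k => p * (1 - p) ^+ k * log_fib_ratio R k) @ \oo --> L).
Proof.
(* [L] must be chosen before any probability space; the bound on [mean] involves only [N] and
   [p]. *)
suff [L [C LC] L1] : exists2 L : R,
    exists C, forall m, `|mean N (binomial_pmf N p) m (@log_head R)
      (initial_state R N) - m%:R * L| <= C &
    N = 1%N -> series (fun k => p * (1 - p) ^+ k * log_fib_ratio R k) @ \oo --> L.
  exists L; split=> [d T P theta X BF|/L1 {}L1]; first exact: (BF_cvg hp BF LC).
  split=> // d T P G geoG; apply: expectation_geometric geoG _ L1.
  exact: log_fib_ratio_ge0.
(* For [N = 1] the explicit value is taken as [L] at once and its linear bound comes from the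
   martingale, so no two limits have to be identified. *)
have [N1|N1] := eqVneq N 1%N; last first.
  have p01 : 0 <= p <= 1 by case/andP: hp => p0 p1; rewrite !ltW.
  have [L [C LC]] := mean_log_head_linear (fun a => binomial_pmf_ge0 N a p01)
    (binomial_pmf_sum1 N p) (good_initial_state R N).
  by exists L; [exists C|move=> /eqP; rewrite (negbTE N1)].
subst N; exists (p * discounted p 0); last first.
  by move=> _; exact: series_log_fib_ratio.
set s := initial_state R 1.
have [s0 s1] : s`_0 = (fib 3)%:R /\ s`_1 = (fib 2)%:R.
  by rewrite /s /initial_state !nth_history.
exists (ln 2 / p + `|log_head s + discounted p 0 - log_fib_ratio R 0|) => m.
(* The initial terms [2] and [1] have ratio [F_3 / F_2], hence index [0]. *)
have := @mean_log_head_bernoulli R p hp m 0 s.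
rewrite s0 s1 !ltr0n => /(_ isT isT erefl).
set u := mean _ _ _ _ _; set v := log_head s + _ - _ => h.
rewrite -[u - _](subrK v) (le_trans (ler_normD _ _))// lerD2r.
by rewrite (_ : _ - v = u - (v + m%:R * (p * discounted p 0)))//; ring.
Qed.
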